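(* Let $\mathcal{X}\in\mathbb{R}^{I_1\times\cdots\times I_N}$ be a tensor, let $\mathcal{G}_k\in\mathbb{R}^{R_k\times I_k\times R_{k+1}}$ ($k=1,\dots,N$, $R_{N+1}=R_1$) be TR-cores, fix $n\in\{1,\dots,N\}$, and put $J_n=\prod_{j\neq n}I_j$. Let $\mathbf{G}^{\neq n}_{[2]}\in\mathbb{R}^{J_n\times R_nR_{n+1}}$ be the mode-2 unfolding of the subchain tensor $\mathcal{G}^{\neq n}$, and let $\mathbf{X}_{[n]}\in\mathbb{R}^{I_n\times J_n}$ be the mode-$n$ unfolding of $\mathcal{X}$. Let $\gamma>1$ be such that $$\|\mathbf{U}(i,:)\|_2^2\le \frac{\gamma R_nR_{n+1}}{J_n}\quad\text{for all } i\in\{1,\dots,J_n\},$$ where $\mathbf{U}\in\mathbb{R}^{J_n\times \mathrm{rank}(\mathbf{G}^{\neq n}_{[2]})}$ has as columns the left singular vectors of $\mathbf{G}^{\neq n}_{[2]}$ belonging to its nonzero singular values. Let $\mathbf{\Psi}_n=\mathbf{D}_n\mathbf{S}_n\in\mathbb{R}^{m\times J_n}$ be the (rescaled) uniform sampling matrix with $m$ samples, and let $$\tilde{\mathbf{G}}_{n(2)}=\arg\min_{\mathbf{G}_{n(2)}\in\mathbb{R}^{I_n\times R_nR_{n+1}}}\left\|\mathbf{X}_{[n]}\mathbf{\Psi}_n^{\top}-\mathbf{G}_{n(2)}\left(\mathbf{\Psi}_n\mathbf{G}^{\neq n}_{[2]}\right)^{\top}\right\|_F .$$ Let $\varepsilon\in(0,1)$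 and $\delta\in(0,1)$. If $$m\ \ge\ \left(\frac{2\gamma R_nR_{n+1}}{\varepsilon}\right)\max\left[\frac{48}{\varepsilon}\ln\left(\frac{96\gamma R_nR_{n+1}}{\varepsilon^2\sqrt{\delta}}\right),\ \frac1\delta\right],$$ then, with probability at least $1-\delta$, $$\left\|\mathbf{X}_{[n]}-\tilde{\mathbf{G}}_{n(2)}\left(\mathbf{G}^{\neq n}_{[2]}\right)^{\top}\right\|_F\le(1+\varepsilon)\min_{\mathbf{G}_{n(2)}\in\mathbb{R}^{I_n\times R_nR_{n+1}}}\left\|\mathbf{X}_{[n]}-\mathbf{G}_{n(2)}\left(\mathbf{G}^{\neq n}_{[2]}\right)^{\top}\right\|_F .$$
   Context: Index convention: for $i_k\in\{1,\dots,I_k\}$, $\overline{i_1i_2\cdots i_N}=1+\sum_{k=1}^N(i_k-1)\prod_{j=1}^{k-1}I_j$ (first index varies fastest), and similarly for any other ordered list of indices. Unfoldings: the mode-$n$ unfolding of $\mathcal{X}\in\mathbb{R}^{I_1\times\cdots\times I_N}$ is the $I_n\times\prod_{j\ne n}I_j$ matrix with $\mathbf{X}_{[n]}(i_n,\overline{i_{n+1}\cdots i_Ni_1\cdots i_{n-1}})=\mathcal{X}(i_1,\dots,i_N)$. The classical mode-$n$ unfolding is $\mathbf{X}_{(n)}(i_n,\overline{i_1\cdots i_{n-1}i_{n+1}\cdots i_N})=\mathcal{X}(i_1,\dots,i_N)$; $\mathbf{G}_{n(2)}\in\mathbb{R}^{I_n\times R_nR_{n+1}}$ denotes the classical mode-2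 unfolding of a core $\mathcal{G}_n\in\mathbb{R}^{R_n\times I_n\times R_{n+1}}$ (so minimizing over $\mathcal{G}_n$ is the same as minimizing over all real $I_n\times R_nR_{n+1}$ matrices). TR-cores and subchain tensor: write $\mathbf{G}_k(i_k)=\mathcal{G}_k(:,i_k,:)\in\mathbb{R}^{R_k\times R_{k+1}}$ for the lateral slices, with $R_{N+1}=R_1$. The subchain tensor $\mathcal{G}^{\neq n}\in\mathbb{R}^{R_{n+1}\times J_n\times R_n}$ is defined by its lateral slices $$\mathbf{G}^{\neq n}(\overline{i_{n+1}\cdots i_Ni_1\cdots i_{n-1}})=\mathbf{G}_{n+1}(i_{n+1})\cdots\mathbf{G}_N(i_N)\,\mathbf{G}_1(i_1)\cdots\mathbf{G}_{n-1}(i_{n-1}),$$ and $\mathbf{G}^{\neq n}_{[2]}$ is its mode-2 unfolding, of size $J_n\times R_nR_{n+1}$. Uniform sampling matrix: $\mathbf{\Psi}_n=\mathbf{D}_n\mathbf{S}_n$, where $\mathbf{S}_n\in\mathbb{R}^{m\times J_n}$ has $(\mathbf{S}_n)_{ij}=1$ if index $j$ is chosen in the $i$-th of $m$ independent random trials, each trial choosing an index of $\{1,\dots,J_n\}$ uniformly (probability $1/J_n$ each), and $(\mathbf{S}_n)_{ij}=0$ otherwise; $\mathbf{D}_n\in\mathbb{R}^{m\times m}$ is diagonal with $(\mathbf{D}_n)_{ii}=\sqrt{J_n/m}$. In the streaming setting, mode $N$ is time and $I_N$ is the temporal dimension of the tensor being sketched. Probability is over the random sampling. *)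

(* Defs.v *)
From mathcomp Require Import all_boot all_order all_algebra.
From mathcomp Require Import zify.
From mathcomp Require Import boolp reals exp.

Set Implicit Arguments.
Unset Strict Implicit.
Unset Printing Implicit Defensive.
Import Order.TTheory GRing.Theory Num.Theory.
Local Open Scope ring_scope.

(** * Linear indexing

   All indices are 0-based, so the linear index of (i_1, ..., i_M), first index
   fastest, is the mixed-radix number \sum_k i_k \prod_(l < k) I_l. *)

Definition linear_index (M : nat) (d f : nat -> nat) : nat :=
  (\sum_(k < M) f k * \prod_(l < k) d l)%N.

(* [read code F c] is [F t] for the [t] with [code t = c], see [readE]; the
   value 0 is only returned when no [t] has code [c]. *)
Definition read (T : finType) (K : eqType) (Z : nmodType)
    (code : T -> K) (F : T -> Z) (c : K) : Z :=
  if [pick t | code t == c] is Some t then F t else 0.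

Lemma readE (T : finType) (K : eqType) (Z : nmodType)
    (code : T -> K) (F : T -> Z) (t : T) :
  (forall t', code t' = code t -> F t' = F t) -> read code F (code t) = F t.
Proof.
move=> h; rewrite /read; case: pickP => [t' /eqP /h //|/(_ t)].
by rewrite eqxx.
Qed.

Lemma linear_index_lt M (d f : nat -> nat) :
  (forall k, (k < M)%N -> (f k < d k)%N) ->
  (linear_index M d f < \prod_(l < M) d l)%N.
Proof.
elim: M => [|M IH] h; first by rewrite /linear_index !big_ord0.
have {}IH := IH (fun k kM => h k (ltnW kM)).
rewrite /linear_index !big_ord_recr /= -/(linear_index M d f).
have le := leq_mul (h M (ltnSn M)) (leqnn (\prod_(l < M) d l)).
rewrite [X in (_ < X)%N]mulnC; apply: leq_trans le.
by rewrite mulSn ltn_add2r.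
Qed.

Lemma linear_index_inj M (d f g : nat -> nat) :
  (forall k, (k < M)%N -> (f k < d k)%N) ->
  (forall k, (k < M)%N -> (g k < d k)%N) ->
  linear_index M d f = linear_index M d g ->
  forall k, (k < M)%N -> f k = g k.
Proof.
elim: M => [|M IH] // hf hg.
have hf' := fun k kM => hf k (@ltnW k.+1 M.+1 kM).
have hg' := fun k kM => hg k (@ltnW k.+1 M.+1 kM).
have lf := linear_index_lt hf'; have lg := linear_index_lt hg'.
rewrite /linear_index !big_ord_recr /= -!/(linear_index M d _) => e k.
have eM : f M = g M.
  have := congr1 (divn^~ (\prod_(l < M) d l)%N) e.
  by rewrite /= ![(_ + _ * _)%N]addnC !divnMDl ?(leq_ltn_trans _ lf) // !divn_small ?addn0.
have eI : linear_index M d f = linear_index M d g.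
  by move: e; rewrite eM => /addIn.
by rewrite ltnS leq_eqVlt => /predU1P[-> //|]; apply: IH.
Qed.

(** * Tensors, cyclic order of the modes, mode-n unfolding *)

Section Tensors.
Variables (N : nat) (d : 'I_N -> nat).

Definition multi_index := {dffun forall k : 'I_N, 'I_(d k)}.

(* The modes n+1, ..., N, 1, ..., n-1 are [cyc_mode n k] for k = 0, ..., N-2;
   [ordS] is the cyclic successor. *)
Definition cyc_mode (n : 'I_N) (k : nat) : 'I_N := iter k (@ordS N) (ordS n).

Definition other_size (n : 'I_N) : nat := (\prod_(j < N | j != n) d j)%N.

Definition other_index (n : 'I_N) (i : multi_index) : nat :=
  linear_index N.-1 (fun k => d (cyc_mode n k)) (fun k => i (cyc_mode n k)).

Lemma cyc_modeE (n : 'I_N) k : cyc_mode n k = ((n + k.+1) %% N)%N :> nat.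
Proof.
elim: k => [|k IH] /=; first by rewrite addn1.
by rewrite IH -addn1 modnDml addn1 -addnS.
Qed.

Lemma cyc_mode_last (n : 'I_N) : cyc_mode n N.-1 = n.
Proof.
apply: val_inj; rewrite /= cyc_modeE prednK ?modnDr ?modn_small //.
by case: N n => [[]|].
Qed.

Lemma cyc_mode_inj (n : 'I_N) k l : (k < N)%N -> (l < N)%N ->
  cyc_mode n k = cyc_mode n l -> k = l.
Proof.
move=> kN lN /(congr1 val) /=; rewrite !cyc_modeE => /eqP.
by rewrite eqn_modDl -!(addn1 k) -!(addn1 l) eqn_modDr !modn_small // => /eqP.
Qed.

Lemma cyc_mode_surj (n p : 'I_N) : p != n ->
  exists2 k, (k < N.-1)%N & cyc_mode n k = p.
Proof.
have N_gt0 : (0 < N)%N by case: N n => [[]|].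
have inj : injective (fun k : 'I_N => cyc_mode n k).
  by move=> k l /(cyc_mode_inj (ltn_ord k) (ltn_ord l)) /val_inj.
move=> pn; have [f fK Kf] := injF_bij inj.
exists (f p); last exact: Kf.
rewrite ltn_neqAle -ltnS prednK // ltn_ord andbT.
apply: contraNneq pn => e.
by rewrite -(Kf p) e cyc_mode_last.
Qed.

Lemma other_sizeE (n : 'I_N) :
  other_size n = (\prod_(k < N.-1) d (cyc_mode n k))%N.
Proof.
have inj : injective (fun k : 'I_N.-1 => cyc_mode n k).
  move=> k l /cyc_mode_inj e; apply/val_inj/e.
    by have := ltn_ord k; lia.
  by have := ltn_ord l; lia.
rewrite /other_size -(big_imset d (in2W inj)) /=.
apply: eq_bigl => j; apply/idP/imsetP => [/cyc_mode_surj[k kN <-]|[k _ ->]].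
  by exists (Ordinal kN).
have kN := ltn_ord k; apply/eqP => e.
have := @cyc_mode_inj n k N.-1; rewrite cyc_mode_last e => /(_ _ _ erefl).
by lia.
Qed.

Lemma other_index_lt (n : 'I_N) (i : multi_index) :
  (other_index n i < other_size n)%N.
Proof. by rewrite other_sizeE; apply: linear_index_lt. Qed.

Lemma other_index_inj (n : 'I_N) (i i' : multi_index) :
  other_index n i = other_index n i' ->
  forall k, (k < N.-1)%N -> i (cyc_mode n k) = i' (cyc_mode n k).
Proof.
move=> e k kN; apply: val_inj => /=.
exact: (linear_index_inj (fun k _ => ltn_ord (i (cyc_mode n k)))
                         (fun k _ => ltn_ord (i' (cyc_mode n k))) e kN).
Qed.

Definition unfolding (R : nmodType) (n : 'I_N) (X : multi_index -> R) :
    'M[R]_(d n, other_size n) :=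
  \matrix_(a, j) read (fun i : multi_index => (i n, other_index n i)) X
                      (a, nat_of_ord j).

Lemma unfoldingE (R : nmodType) (n : 'I_N) (X : multi_index -> R)
    (i : multi_index) :
  unfolding n X (i n) (Ordinal (other_index_lt n i)) = X i.
Proof.
rewrite mxE /= -[(i n, _)]/((fun i : multi_index => (i n, other_index n i)) i).
apply: readE => i' [en /other_index_inj e]; congr X; apply/ffunP => p.
by have [->//|/cyc_mode_surj[k kN <-]] := eqVneq p n; apply: e.
Qed.

End Tensors.

(** * Third-order tensors, tensor-ring cores, subchain tensor *)

Definition tensor3 (R : Type) (p q s : nat) := 'I_p -> 'I_q -> 'I_s -> R.

Definition lateral_slice (R : Type) p q s (T : tensor3 R p q s) (j : 'I_q) :
    'M[R]_(p, s) := \matrix_(a, b) T a j b.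

(* Mode-2 unfolding: the columns are indexed by the third index (fastest),
   then the first one. *)
Definition unfolding2 (R : nmodType) p q s (T : tensor3 R p q s) :
    'M[R]_(q, s * p) :=
  \matrix_(j, c) read (fun ab : 'I_p * 'I_s => ab.2 + ab.1 * s)%N
                      (fun ab => T ab.1 j ab.2) (nat_of_ord c).

Lemma unfolding2E (R : nmodType) p q s (T : tensor3 R p q s)
    (a : 'I_p) (j : 'I_q) (b : 'I_s) (c : 'I_(s * p)) :
  c = (b + a * s)%N :> nat -> unfolding2 T j c = T a j b.
Proof.
move=> ec; rewrite mxE ec.
rewrite -[(b + _)%N]/((fun ab : 'I_p * 'I_s => ab.2 + ab.1 * s)%N (a, b)).
apply: readE => -[a' b'] /= e; have bs := ltn_ord b; have bs' := ltn_ord b'.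
have ea : a' = a by apply: val_inj => /=; nia.
have eb : b' = b by apply: val_inj; move: e; rewrite ea /=; lia.
by rewrite ea eb.
Qed.

(* The ranks are closed up cyclically: R_(N+1) = R_1. *)
Definition tr_cores (R : Type) (N : nat) (d r : 'I_N -> nat) :=
  forall k : 'I_N, tensor3 R (r k) (d k) (r (ordS k)).

Section Subchain.
Variables (R : realType) (N : nat) (d r : 'I_N -> nat).
Variables (G : tr_cores R d r) (n : 'I_N).

(* Product of the first [l] of G_(n+1)(i_(n+1)), ..., G_N(i_N), G_1(i_1), ... *)
Fixpoint slice_prod (i : multi_index d) (l : nat) :
    'M[R]_(r (ordS n), r (cyc_mode n l)) :=
  match l return 'M[R]_(r (ordS n), r (cyc_mode n l)) with
  | 0%N => 1%:M
  | l'.+1 =>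
      slice_prod i l' *m lateral_slice (@G (cyc_mode n l')) (i (cyc_mode n l'))
  end.

Definition full_slice_prod (i : multi_index d) : 'M[R]_(r (ordS n), r n) :=
  castmx (erefl, congr1 r (cyc_mode_last n)) (slice_prod i N.-1).

Definition subchain : tensor3 R (r (ordS n)) (other_size d n) (r n) :=
  fun a j b => read (other_index n) full_slice_prod (nat_of_ord j) a b.

Lemma subchainE (i : multi_index d) :
  lateral_slice subchain (Ordinal (other_index_lt n i)) = full_slice_prod i.
Proof.
apply/matrixP => a b; rewrite mxE /subchain /= readE // => i' /other_index_inj e.
rewrite /full_slice_prod; congr castmx.
suff h l : (l <= N.-1)%N -> slice_prod i' l = slice_prod i l by apply: h.
by elim: l => //= l IH lN; rewrite IH ?e // ltnW.
Qed.

End Subchain.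

Arguments slice_prod {R N d r} G n i l.
Arguments full_slice_prod {R N d r} G n i.
Arguments subchain {R N d r} G n a j b.

(** * Least squares, singular vectors, uniform sampling *)

Definition frob (R : realType) (p q : nat) (A : 'M[R]_(p, q)) : R :=
  Num.sqrt (\sum_i \sum_j A i j ^+ 2).

Definition is_argmin (R : realType) (T : Type) (f : T -> R) (x : T) : Prop :=
  forall y, f x <= f y.

(* [U] is the left factor of a compact singular value decomposition of [A]. *)
Definition left_singular_vectors (R : realType) (p q : nat) (A : 'M[R]_(p, q))
    (U : 'M[R]_(p, \rank A)) : Prop :=
  exists (V : 'M[R]_(q, \rank A)) (s : 'rV[R]_(\rank A)),
    [/\ U^T *m U = 1%:M, V^T *m V = 1%:M, forall k, 0 < s 0 k &
        A = U *m diag_mx s *m V^T].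

Arguments left_singular_vectors {R p q} A U.

(* An outcome of the [m] trials is the function sending each trial to the index
   it selects. *)
Definition trials (m J : nat) := {ffun 'I_m -> 'I_J}.

Definition uniform_sampling (R : realType) (m J : nat) (w : trials m J) :
    'M[R]_(m, J) :=
  diag_mx (const_mx (Num.sqrt (J%:R / m%:R))) *m \matrix_(i, j) (w i == j)%:R.

(* Independent trials, each selecting every index with probability 1/J. *)
Definition trials_prob (R : realType) (m J : nat) (E : trials m J -> Prop) : R :=
  \sum_(w : trials m J | `[< E w >]) \prod_(i < m) J%:R^-1.

(* Main.v *)
Require Import Defs.
From mathcomp Require Import all_boot all_order all_algebra.
From mathcomp Require Import ring lra zify.
From mathcomp Require Import boolp reals sequences exp.

(* The sketched minimizer is compared with the true one through two events on
   the sampled rows x_i = sqrt(J/m) U(i,:), where F denotes the residual of the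
   full least-squares problem: the Gram matrix S of the sample is at least 3/5,
   and |F Psi^T Psi U|^2 <= (18/25) eps |F|^2.  Optimality of the sketched
   minimizer along the line through the true one then bounds the squared loss
   by (1 + 2 eps) |F|^2.  The second event is Markov's inequality, as the
   summands are independent with mean F U / m = 0.
   The first one is a matrix Chernoff bound, proved with the potential
   tr (c - S)^q in place of the usual tr exp(-s S), so that neither matrix
   exponentials nor the Golden-Thompson inequality are needed: for a rank one
   update T' = T - x^T x one telescopes tr T^q - tr T'^q into the products
   <x T^i, x T'^j> with i + j = q - 1, each of which is almost x T^(q-1) x^T by
   log-convexity of the moments x T^j x^T. *)

Set Implicit Arguments.
Unset Strict Implicit.
Unset Printing Implicit Defensive.
Import Order.TTheory GRing.Theory Num.Theory.
Local Open Scope ring_scope.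

(** * Frobenius inner product and positive semidefinite matrices *)


Section Fdot.
Variable R : realFieldType.

Definition fdot (p q : nat) (A B : 'M[R]_(p, q)) : R := \tr (A *m B^T).

Lemma fdotE p q (A B : 'M[R]_(p, q)) :
  fdot A B = \sum_i \sum_j A i j * B i j.
Proof.
apply: eq_bigr => i _; rewrite mxE; apply: eq_bigr => j _.
by rewrite mxE.
Qed.

Lemma fdotC p q (A B : 'M[R]_(p, q)) : fdot A B = fdot B A.
Proof. by rewrite /fdot -mxtrace_tr trmx_mul trmxK. Qed.

Lemma fdotDl p q (A B C : 'M[R]_(p, q)) : fdot (A + B) C = fdot A C + fdot B C.
Proof. by rewrite /fdot mulmxDl mxtraceD. Qed.

Lemma fdotZl p q a (A B : 'M[R]_(p, q)) : fdot (a *: A) B = a * fdot A B.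
Proof. by rewrite /fdot -scalemxAl mxtraceZ. Qed.

Lemma fdotBl p q (A B C : 'M[R]_(p, q)) : fdot (A - B) C = fdot A C - fdot B C.
Proof. by rewrite -scaleN1r fdotDl fdotZl mulN1r. Qed.

Lemma fdotDr p q (A B C : 'M[R]_(p, q)) : fdot A (B + C) = fdot A B + fdot A C.
Proof. by rewrite fdotC fdotDl !(fdotC A). Qed.

Lemma fdotZr p q a (A B : 'M[R]_(p, q)) : fdot A (a *: B) = a * fdot A B.
Proof. by rewrite fdotC fdotZl (fdotC A). Qed.

Lemma fdotBr p q (A B C : 'M[R]_(p, q)) : fdot A (B - C) = fdot A B - fdot A C.
Proof. by rewrite fdotC fdotBl !(fdotC A). Qed.

Lemma fdot0l p q (A : 'M[R]_(p, q)) : fdot 0 A = 0.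
Proof. by rewrite /fdot mul0mx mxtrace0. Qed.

Lemma fdot0r p q (A : 'M[R]_(p, q)) : fdot A 0 = 0.
Proof. by rewrite fdotC fdot0l. Qed.

Lemma fdot_mull p q s (A : 'M[R]_(p, q)) (M : 'M[R]_(q, s)) B :
  fdot (A *m M) B = fdot A (B *m M^T).
Proof. by rewrite /fdot trmx_mul trmxK mulmxA. Qed.

Lemma fdot_sqE p q (A : 'M[R]_(p, q)) : fdot A A = \sum_i \sum_j A i j ^+ 2.
Proof. by rewrite fdotE. Qed.

Lemma fdot_ge0 p q (A : 'M[R]_(p, q)) : 0 <= fdot A A.
Proof. by rewrite fdot_sqE !sumr_ge0 // => i _; rewrite sumr_ge0 // => j _; rewrite sqr_ge0. Qed.

Lemma fdot_eq0 p q (A : 'M[R]_(p, q)) : (fdot A A == 0) = (A == 0).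
Proof.
apply/idP/eqP => [|->]; last by rewrite fdot0l.
rewrite fdot_sqE psumr_eq0; last by move=> i _; rewrite sumr_ge0 // => j _; rewrite sqr_ge0.
move=> /allP h; apply/matrixP => i j.
have := h i (mem_index_enum i); rewrite /= psumr_eq0; last by move=> l _; rewrite sqr_ge0.
by move=> /allP /(_ j (mem_index_enum j)) /=; rewrite sqrf_eq0 mxE => /eqP.
Qed.

(** The quadratic is evaluated at its minimizer -b/c. Allowing c = 0 keeps degenerate forms in
    scope; there the polynomial is affine and must be constant. *)
Lemma quadratic_discr (a b c : R) :
  0 <= c -> (forall t, 0 <= a + 2 * t * b + t ^+ 2 * c) -> b ^+ 2 <= a * c.
Proof.
rewrite le_eqVlt => /predU1P[<-|c_gt0] h.
  have [->|b0] := eqVneq b 0; first by rewrite expr0n /= mulr0.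
  (* This t makes the affine function a + 2tb equal to -1. *)
  have := h (- (a + 1) / (2 * b)).
  suff -> : a + 2 * (- (a + 1) / (2 * b)) * b + (- (a + 1) / (2 * b)) ^+ 2 * 0 = -1 by lra.
  by field.
have := h (- b / c).
suff -> : a + 2 * (- b / c) * b + (- b / c) ^+ 2 * c = (a * c - b ^+ 2) / c.
  by rewrite pmulr_lge0 ?invr_gt0 // subr_ge0.
by field; rewrite gt_eqF.
Qed.

(** The Loewner order A <= B is written [psd (B - A)] throughout. *)
Definition psd n (A : 'M[R]_n) : Prop :=
  A^T = A /\ forall x : 'rV_n, 0 <= fdot (x *m A) x.

Lemma psdD n (A B : 'M[R]_n) : psd A -> psd B -> psd (A + B).
Proof.
move=> [sA pA] [sB pB]; split; first by rewrite linearD /= sA sB.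
by move=> x; rewrite mulmxDr fdotDl addr_ge0.
Qed.

Lemma psdZ n a (A : 'M[R]_n) : 0 <= a -> psd A -> psd (a *: A).
Proof.
move=> a0 [sA pA]; split; first by rewrite linearZ /= sA.
by move=> x; rewrite -scalemxAr fdotZl mulr_ge0.
Qed.

Lemma psd_scalar n (a : R) : 0 <= a -> psd (a%:M : 'M_n).
Proof.
move=> a0; split; first by rewrite tr_scalar_mx.
by move=> x; rewrite mul_mx_scalar fdotZl mulr_ge0 ?fdot_ge0.
Qed.

Lemma psd_conj n p (A : 'M[R]_n) (B : 'M[R]_(p, n)) :
  psd A -> psd (B *m A *m B^T).
Proof.
move=> [sA pA]; split; first by rewrite !trmx_mul trmxK sA mulmxA.
by move=> x; rewrite mulmxA fdot_mull trmxK mulmxA.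
Qed.

Lemma psd_gram n p (B : 'M[R]_(p, n)) : psd (B^T *m B).
Proof.
have := psd_conj B^T (@psd_scalar p 1 ler01).
by rewrite mulmx1 trmxK.
Qed.

Lemma psd_cauchy n (A : 'M[R]_n) (x y : 'rV_n) : psd A ->
  fdot (x *m A) y ^+ 2 <= fdot (x *m A) x * fdot (y *m A) y.
Proof.
move=> [sA pA]; apply: quadratic_discr => // t.
have := pA (x + t *: y).
rewrite mulmxDl -scalemxAl !(fdotDl, fdotDr, fdotZl, fdotZr).
rewrite (fdotC (y *m A)) -{3}sA -fdot_mull => h; rewrite -/(fdot _ _).
lra.
Qed.

Lemma fdot_cauchy p q (A B : 'M[R]_(p, q)) :
  fdot A B ^+ 2 <= fdot A A * fdot B B.
Proof.
apply: quadratic_discr (fdot_ge0 B) _ => t.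
have := fdot_ge0 (A + t *: B).
by rewrite !(fdotDl, fdotDr, fdotZl, fdotZr) (fdotC B A) => h; lra.
Qed.

Lemma fdot_delta n (v : 'rV[R]_n) i : fdot (delta_mx 0 i) v = v 0 i.
Proof.
rewrite fdotE big_ord1 (bigD1 i) //= big1 ?addr0.
  by rewrite !mxE !eqxx mul1r.
by move=> j ji; rewrite !mxE (negPf ji) andbF mul0r.
Qed.

Lemma mxtrace_rows n (M : 'M[R]_n) :
  \tr M = \sum_i fdot (delta_mx 0 i *m M) (delta_mx 0 i : 'rV_n).
Proof.
by apply: eq_bigr => i _; rewrite -rowE fdotC fdot_delta mxE.
Qed.

Lemma psd_trace_ge0 n (M : 'M[R]_n) : psd M -> 0 <= \tr M.
Proof. by move=> [_ h]; rewrite mxtrace_rows sumr_ge0. Qed.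

(** With a = <yM, y>, Cauchy-Schwarz for the form [M] bounds each squared entry of yM by a diagonal
    entry of [M] times a. So |yM|^2 <= a tr M, hence a^2 <= a |y|^2 tr M, and a cancels. *)
Lemma psd_le_trace n (M : 'M[R]_n) (y : 'rV_n) : psd M ->
  fdot (y *m M) y <= \tr M * fdot y y.
Proof.
move=> pM; have [sM M0] := pM; set a := fdot _ _.
have : a ^+ 2 <= (\tr M * fdot y y) * a.
  apply: (le_trans (fdot_cauchy _ _)).
  rewrite mulrAC ler_wpM2r ?fdot_ge0 //.
  rewrite fdotE big_ord1 mxtrace_rows mulr_suml; apply: ler_sum => i _; rewrite -expr2.
  have -> : (y *m M) 0 i = fdot (delta_mx 0 i *m M) y.
    by rewrite fdot_mull sM fdot_delta.
  exact: psd_cauchy.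
have := M0 y; rewrite -/a le_eqVlt => /predU1P[<- _|a_gt0].
  by apply: mulr_ge0 (psd_trace_ge0 pM) (fdot_ge0 y).
by rewrite expr2 ler_pM2r.
Qed.

End Fdot.

(** * Moments of powers *)


Section Powers.
Variables (R : realFieldType) (n : nat).
Implicit Types (T : 'M[R]_n) (x y : 'rV[R]_n).

Lemma expmxS T j : T ^+ j.+1 = T *m T ^+ j.
Proof. by rewrite exprS. Qed.

Lemma expmxSr T j : T ^+ j.+1 = T ^+ j *m T.
Proof. by rewrite exprSr. Qed.

Lemma trmxX T j : T^T = T -> (T ^+ j)^T = T ^+ j.
Proof.
move=> sT; elim: j => [|j IH]; first by rewrite expr0 trmx1.
by rewrite {1}expmxS trmx_mul IH sT -expmxSr.
Qed.

Lemma expmx_psd_conj T A i : T^T = T -> psd A -> psd (T ^+ i *m A *m T ^+ i).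
Proof. by move=> sT pA; have := psd_conj (T ^+ i) pA; rewrite trmxX. Qed.

(** By the parity of j, [T ^+ j] is 1 or [T] conjugated by [T ^+ j./2]. *)
Lemma psdX T j : psd T -> psd (T ^+ j).
Proof.
move=> pT; have sT := pT.1; rewrite -[j]odd_double_half -addnn addnA exprD.
case: (odd j); first by rewrite add1n expmxSr -mulmxE; apply: expmx_psd_conj.
by have := expmx_psd_conj j./2 sT (@psd_scalar R n 1 ler01); rewrite mulmx1.
Qed.

(** The matrix T^j W with W = T - c is psd: half powers of [T] commute with W and conjugate either W
    or, for odd j, T W = W^2 + c W. *)
Lemma mom_succ_ge T x c j : 0 <= c -> psd (T - c%:M) ->
  c * fdot (x *m T ^+ j) x <= fdot (x *m T ^+ j.+1) x.
Proof.
move=> c0 pW; set W := T - c%:M in pW.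
have ET : T = W + c%:M by rewrite /W subrK.
have sT : T^T = T by rewrite ET linearD /= tr_scalar_mx pW.1.
have pP : psd (T ^+ j *m W).
  rewrite -[j]odd_double_half -addnn addnA exprD -mulmxE -mulmxA.
  set a := j./2; have cW : T ^+ a *m W = W *m T ^+ a.
    by rewrite /W mulmxBl mulmxBr -expmxS -expmxSr mul_scalar_mx mul_mx_scalar.
  rewrite cW mulmxA; case: (odd j); last first.
    by rewrite add0n; apply: expmx_psd_conj.
  rewrite add1n expmxSr -[_ *m T *m W]mulmxA; apply: expmx_psd_conj => //.
  rewrite {1}ET mulmxDl mul_scalar_mx; apply: psdD (psdZ c0 pW).
  by have := psd_gram W; rewrite pW.1.
have := pP.2 x.
by rewrite /W mulmxBr mul_mx_scalar -expmxSr mulmxBr -scalemxAr fdotBl fdotZl subr_ge0.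
Qed.

Lemma mom_succ_le T x c j : 0 < c -> psd T -> psd (c%:M - T) ->
  fdot (x *m T ^+ j.+1) x <= c * fdot (x *m T ^+ j) x.
Proof.
move=> c0 pT pW; set W := c%:M - T in pW; have sT := pT.1.
have ET : c%:M = T + W by rewrite /W addrC subrK.
have pP : psd (T ^+ j *m W).
  rewrite -[j]odd_double_half -addnn addnA exprD -mulmxE -mulmxA.
  set a := j./2; have cW : T ^+ a *m W = W *m T ^+ a.
    by rewrite /W mulmxBl mulmxBr -expmxS -expmxSr mul_scalar_mx mul_mx_scalar.
  rewrite cW mulmxA; case: (odd j); last first.
    by rewrite add0n; apply: expmx_psd_conj.
  rewrite add1n expmxSr -[_ *m T *m W]mulmxA; apply: expmx_psd_conj => //.
  have cTW : T *m W = W *m T.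
    by rewrite /W mulmxBl mulmxBr mul_scalar_mx mul_mx_scalar.
  (* Since T + W = c and the two commute, c T W = T W T + W T W, a sum of conjugates of psd
     matrices. *)
  have -> : T *m W = c^-1 *: (T *m W *m T^T + W *m T *m W^T).
    rewrite sT pW.1 -cTW -mulmxDr -ET.
    by rewrite mul_mx_scalar scalerA mulVf ?gt_eqF // scale1r.
  by apply: psdZ; rewrite ?invr_ge0 ?ltW //; apply: psdD; apply: psd_conj.
have := pP.2 x.
by rewrite /W mulmxBr mul_mx_scalar -expmxSr mulmxBr -scalemxAr fdotBl fdotZl subr_ge0.
Qed.

Lemma mom_logconvex T x j : psd T ->
  fdot (x *m T ^+ j.+1) x ^+ 2 <= fdot (x *m T ^+ j) x * fdot (x *m T ^+ j.+2) x.
Proof.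
move=> pT; have := psd_cauchy x (x *m T) (psdX j pT).
have -> : fdot (x *m T ^+ j) (x *m T) = fdot (x *m T ^+ j.+1) x.
  by rewrite expmxSr mulmxA (fdot_mull _ T x) pT.1.
suff -> : fdot (x *m T *m T ^+ j) (x *m T) = fdot (x *m T ^+ j.+2) x by [].
by rewrite expmxSr expmxS !mulmxA (fdot_mull _ T x) pT.1.
Qed.

End Powers.

(** Log-convexity makes the ratios g(i+1)/g(i) nondecreasing; [ratio] states this with denominators
    cleared, and l such comparisons are multiplied. *)
Lemma logconvex_mul (R : realFieldType) (g : nat -> R) (l j : nat) :
  (forall i, 0 < g i) -> (forall i, g i.+1 ^+ 2 <= g i * g i.+2) ->
  g l * g j <= g 0%N * g (l + j)%N.
Proof.
move=> g_gt0 lc.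
have ratio a b : g a.+1 * g (a + b)%N <= g a * g (a + b).+1.
  elim: b => [|b IH]; first by rewrite addn0 mulrC.
  rewrite addnS -(ler_pM2r (g_gt0 (a + b).+1)) -mulrA -expr2.
  apply: (le_trans (ler_wpM2l (ltW (g_gt0 _)) (lc _))).
  by rewrite mulrA [leRHS]mulrAC ler_wpM2r ?(ltW (g_gt0 _)).
elim: l => [|l IH]; first by rewrite add0n.
rewrite -(ler_pM2r (mulr_gt0 (g_gt0 l) (g_gt0 (l + j)%N))).
have := ler_pM _ _ IH (ratio l j); rewrite !mulr_ge0 ?(ltW (g_gt0 _)) // => /(_ isT isT).
by congr (_ <= _); rewrite ?addSn; ring.
Qed.

(** * Rank one updates *)


Section RankOneStep.
Variables (R : realFieldType) (n : nat).
Implicit Types (T : 'M[R]_n) (x y : 'rV[R]_n).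

Lemma psd_sub_ge0 T c : 0 <= c -> psd (T - c%:M) -> psd T.
Proof. by move=> c0 /psdD /(_ (psd_scalar n c0)); rewrite subrK. Qed.

Lemma mom_gt0 T x c j : 0 < c -> psd (T - c%:M) -> x != 0 ->
  0 < fdot (x *m T ^+ j) x.
Proof.
move=> c0 pT x0; elim: j => [|j IH].
  by rewrite expr0 mulmx1 lt_neqAle fdot_ge0 eq_sym fdot_eq0 x0.
by apply: lt_le_trans (mom_succ_ge x j (ltW c0) pT); rewrite mulr_gt0.
Qed.

(** Under the spectral measure of [T] at [x], the powers t^i and t^j are positively correlated. *)
Lemma mom_mul_le T x c i j : 0 < c -> psd (T - c%:M) ->
  fdot (x *m T ^+ i) x * fdot (x *m T ^+ j) x
    <= fdot x x * fdot (x *m T ^+ (i + j)) x.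
Proof.
move=> c0 pT; have [->|x0] := eqVneq x 0; first by rewrite !fdot0r !mulr0.
have := @logconvex_mul R (fun l => fdot (x *m T ^+ l) x) i j.
rewrite expr0 mulmx1; apply; first by move=> l; apply: mom_gt0 pT x0.
by move=> l; apply: mom_logconvex; apply: psd_sub_ge0 (ltW c0) pT.
Qed.

Lemma mulmx_outer p (v : 'M[R]_(1, p)) (x : 'rV[R]_p) :
  v *m (x^T *m x) = fdot v x *: x.
Proof.
by rewrite mulmxA [v *m _]mx11_scalar mul_scalar_mx /fdot trace_mx11.
Qed.

(** * Mixed inner products of powers of [T] and its rank one update [T'] *)

Section Cross.
Variables (T : 'M[R]_n) (x : 'rV[R]_n) (c : R).
Hypotheses (c_gt0 : 0 < c) (pT : psd (T - c%:M)).
Hypothesis pT' : psd (T - x^T *m x - c%:M).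
Let T' := T - x^T *m x.

Let sT : T^T = T. Proof. exact: (psd_sub_ge0 (ltW c_gt0) pT).1. Qed.
Let psdT' : psd T'. Proof. exact: (psd_sub_ge0 (ltW c_gt0) pT'). Qed.

(** One factor moves across the inner product and turns from [T'] into [T]; the rank one part splits
    off a product. *)
Lemma cross_succ i j :
  fdot (x *m T ^+ i) (x *m T' ^+ j.+1) =
  fdot (x *m T ^+ i.+1) (x *m T' ^+ j)
    - fdot (x *m T ^+ i) x * fdot x (x *m T' ^+ j).
Proof.
rewrite (expmxSr T') mulmxA {2}/T' mulmxBr fdotBr mulmx_outer fdotZr.
rewrite [in RHS]expmxSr [in RHS]mulmxA (fdot_mull _ T) sT.
by rewrite (fdotC x) [X in _ - X]mulrC.
Qed.

Lemma cross_le i j :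
  fdot (x *m T ^+ i) (x *m T' ^+ j) <= fdot (x *m T ^+ (i + j)) x.
Proof.
elim: j i => [|j IH] i; first by rewrite addn0 expr0 mulmx1.
rewrite cross_succ addnS -addSn; apply: le_trans (IH _).
rewrite gerBl mulr_ge0 //; last by rewrite fdotC (psdX j psdT').2.
exact: (psdX i (psd_sub_ge0 (ltW c_gt0) pT)).2.
Qed.

(** Each of the j moves by [cross_succ] costs at most |x|^2 times the moment of order i + j - 1, by
    [cross_le] and [mom_mul_le]. The predecessor truncates only at i = j = 0, where its coefficient
    vanishes. *)
Lemma cross_ge i j :
  fdot (x *m T ^+ (i + j)) x - j%:R * (fdot x x * fdot (x *m T ^+ (i + j).-1) x)
    <= fdot (x *m T ^+ i) (x *m T' ^+ j).
Proof.
elim: j i => [|j IH] i; first by rewrite addn0 mul0r subr0 [T' ^+ 0]expr0 mulmx1.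
have := IH i.+1; rewrite cross_succ addnS addSn /=.
have pi := (psdX i (psd_sub_ge0 (ltW c_gt0) pT)).2 x.
have hj : fdot x (x *m T' ^+ j) <= fdot (x *m T ^+ j) x.
  by have := cross_le 0 j; rewrite expr0 mulmx1.
have := mom_mul_le x i j c_gt0 pT; have := ler_wpM2l pi hj.
by rewrite mulrSr; lra.
Qed.

(** As T >= c, the moment of order Q - 1 is at most 1/c times that of order Q, so the loss in
    [cross_ge] becomes relative. *)
Lemma cross_ge_scaled K Q i j : (i + j = Q)%N -> fdot x x <= K ->
  (1 - Q%:R * K / c) * fdot (x *m T ^+ Q) x <= fdot (x *m T ^+ i) (x *m T' ^+ j).
Proof.
move=> <- {Q} xK; apply: le_trans (cross_ge i j).
have K0 := le_trans (fdot_ge0 x) xK.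
have g0 l := (psdX l (psd_sub_ge0 (ltW c_gt0) pT)).2 x.
rewrite mulrBl mul1r lerB //.
case: j => [|j]; first by rewrite mul0r !mulr_ge0 ?invr_ge0 ?(ltW c_gt0).
have := mom_succ_ge x (i + j) (ltW c_gt0) pT; rewrite -addnS => hc.
have -> : (i + j.+1).-1 = (i + j)%N by lia.
rewrite -!mulrA ler_pM ?mulr_ge0 ?fdot_ge0 ?ler_nat ?leq_addl //.
rewrite ler_pM ?fdot_ge0 // mulrC ler_pdivlMr // mulrC //.
Qed.

Lemma trace_telescope i j :
  \tr (T ^+ i *m T' ^+ j.+1) =
  \tr (T ^+ i.+1 *m T' ^+ j) - fdot (x *m T ^+ i) (x *m T' ^+ j).
Proof.
rewrite (expmxS T') {1}/T' mulmxBl mulmxBr linearB /= mulmxA -expmxSr.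
congr (_ - _); rewrite -!mulmxA mxtrace_mulC mxtrace_mulC !mulmxA.
rewrite fdotC /fdot trmx_mul trmxX // mxtrace_mulC !mulmxA.
by rewrite mxtrace_mulC !mulmxA.
Qed.

(** A discrete form of d/dt tr (T - t x^T x)^q = -q x T^(q-1) x^T at t = 0, with q = Q + 1: factors
    [T] become [T'] one at a time, each removing a cross term bounded by [cross_ge_scaled]. *)
Lemma trace_step K Q : fdot x x <= K ->
  \tr (T' ^+ Q.+1) <=
  \tr (T ^+ Q.+1) - Q.+1%:R * (1 - Q%:R * K / c) * fdot (x *m T ^+ Q) x.
Proof.
move=> xK.
suff h i j : (i + j = Q.+1)%N -> \tr (T ^+ i *m T' ^+ j) <=
    \tr (T ^+ Q.+1) - j%:R * ((1 - Q%:R * K / c) * fdot (x *m T ^+ Q) x).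
  by have := h 0%N Q.+1 (add0n _); rewrite expr0 mul1mx mulrA.
elim: j i => [|j IH] i ij.
  by rewrite mul0r subr0 [T' ^+ 0]expr0 mulmx1 -ij addn0.
rewrite trace_telescope; have ij' : (i + j = Q)%N by lia.
have := IH i.+1; rewrite addSn ij' => /(_ erefl).
by have := cross_ge_scaled ij' xK; rewrite mulrSr; lra.
Qed.

End Cross.
End RankOneStep.

(** * Trace potential of random sums *)


Section FfunCons.
Variable I : finType.

Definition ffun_cons l (a : I) (w : {ffun 'I_l -> I}) : {ffun 'I_l.+1 -> I} :=
  [ffun i => oapp w a (unlift ord0 i)].

Lemma sum_ffun_recl (V : nmodType) l (F : {ffun 'I_l.+1 -> I} -> V) :
  \sum_w F w = \sum_a \sum_w F (ffun_cons a w).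
Proof.
rewrite pair_bigA /=.
pose h (p : I * {ffun 'I_l -> I}) := ffun_cons p.1 p.2.
pose h' (w : {ffun 'I_l.+1 -> I}) := (w ord0, [ffun i => w (lift ord0 i)]).
rewrite (reindex h) //; exists h' => [[a w] _|w _].
  by congr (_, _); [|apply/ffunP => i]; rewrite !ffunE ?unlift_none ?liftK.
by apply/ffunP => i; rewrite ffunE; case: unliftP => [j|] -> //=; rewrite ffunE.
Qed.

Lemma sum_ffun_cons (V : nmodType) l a (w : {ffun 'I_l -> I}) (f : I -> V) :
  \sum_i f (ffun_cons a w i) = f a + \sum_i f (w i).
Proof.
rewrite big_ord_recl ffunE unlift_none; congr (_ + _).
by apply: eq_bigr => i _; rewrite ffunE liftK.
Qed.

End FfunCons.

Section TracePotential.
Variables (R : realFieldType) (n : nat) (I : finType) (x : I -> 'rV[R]_n).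
Variables (mu K : R).
Hypothesis x_sum : \sum_a (x a)^T *m x a = mu%:M.
Hypothesis x_le : forall a, fdot (x a) (x a) <= K.

Lemma psd_sub_outer (v : 'rV[R]_n) : fdot v v <= K -> psd (K%:M - v^T *m v).
Proof.
move=> vK; split.
  by rewrite linearB /= tr_scalar_mx trmx_mul trmxK.
move=> y; rewrite mulmxBr mul_mx_scalar mulmx_outer fdotBl !fdotZl subr_ge0.
rewrite (fdotC v) -expr2; apply: le_trans (fdot_cauchy _ _) _.
by rewrite mulrC ler_wpM2r ?fdot_ge0.
Qed.

Lemma trace_succ_le (T : 'M[R]_n) c j : 0 < c -> psd T -> psd (c%:M - T) ->
  \tr (T ^+ j.+1) <= c * \tr (T ^+ j).
Proof.
move=> c0 pT pcT; rewrite !mxtrace_rows mulr_sumr.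
by apply: ler_sum => i _; apply: mom_succ_le.
Qed.

Lemma sum_mom (T : 'M[R]_n) Q :
  \sum_a fdot (x a *m T ^+ Q) (x a) = mu * \tr (T ^+ Q).
Proof.
rewrite -mxtraceZ -mul_mx_scalar -x_sum mulmx_sumr linear_sum /=.
by apply: eq_bigr => a _; rewrite /fdot -mulmxA mxtrace_mulC mulmxA.
Qed.

(** By isotropy of the [x a], summing [trace_step] removes a multiple of mu tr T^Q, and T <= c turns
    it into a fraction of tr T^(Q+1). The margin [K] above [b] pays for one update. *)
Lemma mean_trace_step (T : 'M[R]_n) (b c : R) Q :
  0 <= K -> 0 < b -> 0 < c -> 0 <= mu -> Q%:R * K / b <= 1 ->
  psd (T - (b + K)%:M) -> psd (c%:M - T) ->
  \sum_a \tr ((T - (x a)^T *m x a) ^+ Q.+1) <=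
  (#|I|%:R - Q.+1%:R * (1 - Q%:R * K / b) * mu / c) * \tr (T ^+ Q.+1).
Proof.
move=> K0 b0 c0 mu0 Qb pbT pTc.
have pT' a : psd (T - (x a)^T *m x a - b%:M).
  have -> : T - (x a)^T *m x a - b%:M =
      (T - (b + K)%:M) + (K%:M - (x a)^T *m x a).
    by rewrite raddfD /= opprD !addrA subrK addrAC.
  exact: psdD pbT (psd_sub_outer (x_le a)).
have pT : psd (T - b%:M).
  have -> : T - b%:M = (T - (b + K)%:M) + K%:M by rewrite raddfD /= opprD !addrA subrK.
  exact: psdD pbT (psd_scalar n K0).
apply: le_trans (ler_sum _ (fun a _ => trace_step b0 pT (pT' a) Q (x_le a))) _.
rewrite sumrB sumr_const -mulr_sumr sum_mom mulrBl.
apply: lerB; first by rewrite mulr_natl.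
rewrite -!mulrA; apply: ler_wpM2l => //.
apply: ler_wpM2l; first by rewrite subr_ge0 mulrA.
apply: ler_wpM2l => //.
rewrite mulrC ler_pdivrMr // mulrC; apply: trace_succ_le pTc => //.
exact: psd_sub_ge0 (ltW b0) pT.
Qed.

(** Independence enters as iterated summation: the first trial is fixed and the induction hypothesis
    applied to the updated matrix. Each update lowers the lower bound by at most [K], hence
    [K *+ l], while [c] stays an upper bound. *)
Lemma sum_trace_iter (b c theta : R) Q l (T : 'M[R]_n) :
  0 <= K -> 0 < b -> 0 < c -> 0 <= mu -> Q%:R * K / b <= 1 ->
  #|I|%:R - Q.+1%:R * (1 - Q%:R * K / b) * mu / c <= theta -> 0 <= theta ->
  psd (T - (b + K *+ l)%:M) -> psd (c%:M - T) ->
  \sum_(w : {ffun 'I_l -> I})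
     \tr ((T - \sum_i (x (w i))^T *m x (w i)) ^+ Q.+1) <=
  theta ^+ l * \tr (T ^+ Q.+1).
Proof.
move=> K0 b0 c0 mu0 Qb th th0; elim: l T => [|l IH] T pbT pTc.
  rewrite (eq_bigr (fun=> \tr (T ^+ Q.+1))) => [|w _]; last by rewrite big_ord0 subr0.
  by rewrite sumr_const card_ffun card_ord expn0 expr0 mul1r.
rewrite sum_ffun_recl exprSr -mulrA.
have bl0 : 0 < b + K *+ l by rewrite ltr_wpDr ?mulrn_wge0.
rewrite mulrSr addrA in pbT.
have pT : psd T by apply: psd_sub_ge0 pbT; rewrite addr_ge0 ?(ltW bl0).
apply: le_trans (_ : \sum_a theta ^+ l * \tr ((T - (x a)^T *m x a) ^+ Q.+1) <= _).
  apply: ler_sum => a _; apply: le_trans (IH (T - (x a)^T *m x a) _ _).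
  - rewrite le_eqVlt; apply/orP; left; apply/eqP; apply: eq_bigr => w _.
    by rewrite (sum_ffun_cons _ _ (fun a => (x a)^T *m x a)) opprD addrA.
  - have -> : T - (x a)^T *m x a - (b + K *+ l)%:M =
        (T - (b + K *+ l + K)%:M) + (K%:M - (x a)^T *m x a).
      by rewrite [(_ + K)%:M]raddfD /= opprD !addrA subrK addrAC.
    exact: psdD pbT (psd_sub_outer (x_le a)).
  - have -> : c%:M - (T - (x a)^T *m x a) = (c%:M - T) + (x a)^T *m x a.
      by rewrite opprB addrA addrAC.
    exact: psdD pTc (psd_gram _).
rewrite -mulr_sumr ler_wpM2l ?exprn_ge0 //.
apply: le_trans (mean_trace_step (c := c) K0 b0 c0 mu0 Qb _ pTc) _.
  have -> : T - (b + K)%:M = T - (b + K *+ l + K)%:M + (K *+ l)%:M.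
    by rewrite (addrAC b) [(_ + K *+ l)%:M]raddfD /= opprD addrA subrK.
  by apply: psdD pbT (psd_scalar n _); rewrite mulrn_wge0.
by apply: ler_wpM2r => //; apply: psd_trace_ge0; apply: psdX.
Qed.
End TracePotential.

(** * Matrix Chernoff bound *)


Section Chernoff.
Variable R : realFieldType.

Lemma bernoulli_ineq (a : R) N : 0 <= a <= 1 -> 1 - N%:R * a <= (1 - a) ^+ N.
Proof.
move=> /andP[a0 a1]; elim: N => [|N IH]; first by rewrite mul0r subr0 expr0.
have a1' : 0 <= 1 - a by rewrite subr_ge0.
rewrite exprS; apply: le_trans (ler_wpM2l a1' IH).
by rewrite mulrSr; have := ler0n R N; nra.
Qed.

Lemma psd_sum n (I : finType) (M : I -> 'M[R]_n) :
  (forall i, psd (M i)) -> psd (\sum_i M i).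
Proof.
move=> h; apply: big_ind => //; last exact: psdD.
by have := @psd_scalar R n 0 (lexx 0); rewrite raddf0.
Qed.

(** A Jensen inequality: [mom_mul_le] with exponents 1 and q gives <yT^q, y> >= a^q |y|^2 by
    induction, and [psd_le_trace] concludes. *)
Lemma exprn_le_trace n (T : 'M[R]_n) (y : 'rV[R]_n) (a b : R) q :
  0 < b -> psd (T - b%:M) -> y != 0 -> 0 <= a ->
  a * fdot y y <= fdot (y *m T) y -> a ^+ q <= \tr (T ^+ q).
Proof.
move=> b0 pT y0 a0 ay; have pT0 := psd_sub_ge0 (ltW b0) pT.
have y_gt0 : 0 < fdot y y by rewrite lt_neqAle fdot_ge0 eq_sym fdot_eq0 y0.
rewrite -(ler_pM2r y_gt0); apply: le_trans (psd_le_trace y (psdX q pT0)).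
elim: q => [|q IH]; first by rewrite !expr0 mul1r mulmx1.
rewrite exprS -mulrA; apply: le_trans (ler_wpM2l a0 IH) _.
rewrite -(ler_pM2l y_gt0) mulrCA mulrA.
have := mom_mul_le y 1 q b0 pT; rewrite expr1 => /(le_trans _); apply.
by apply: ler_wpM2r ay; apply: (psdX q pT0).2.
Qed.

(** The rows are scaled so that the sampled Gram matrix has mean 1. Outcomes are counted; division
    by #|I|^m gives the probability. *)
Lemma matrix_chernoff n (I : finType) (x : I -> 'rV[R]_n) (m : nat) (k : R) :
  (0 < m)%N -> 1 <= k ->
  \sum_a (x a)^T *m x a = (#|I|%:R / m%:R)%:M ->
  (forall a, fdot (x a) (x a) <= k / m%:R) ->
  \sum_(w : {ffun 'I_m -> I} | `[< exists y : 'rV[R]_n,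
     fdot (y *m \sum_i (x (w i))^T *m x (w i)) y < 3 / 5 * fdot y y >]) 1 <=
  n%:R * (#|I|%:R * (1 - 3 / (100 * k))) ^+ m.
Proof.
move=> m0 k1 xs xK; have mR : 0 < m%:R :> R by rewrite ltr0n.
have k0 : 0 < k by apply: lt_le_trans k1.
set K := k / m%:R in xK; have K0 : 0 <= K by rewrite divr_ge0 ?ltW.
have Km : K *+ m = k by rewrite -mulr_natr /K divfK ?gt_eqF.
set S := fun w : {ffun 'I_m -> I} => \sum_i (x (w i))^T *m x (w i).
(* With q = 20 m and c = 100 k, each step multiplies the mean of tr (c - S)^q by
   at most 1 - 3/(20k), while the bad event forces tr (c - S)^q >= (c - 3/5)^q,
   which is at least c^q (1 - 3/(25k))^m by Bernoulli's inequality. *)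
pose c := 100 * k; pose b := 99 * k.
have b0 : 0 < b by rewrite /b; lra.
have c0 : 0 < c by rewrite /c; lra.
have [e Ee] : exists e, e = 20%N by exists 20%N.
have [Q EQ] : exists Q, (e * m = Q.+1)%N by exists (e * m).-1; lia.
have QR : Q.+1%:R = 20 * m%:R :> R by rewrite -EQ natrM Ee.
pose th : R := #|I|%:R * (1 - 3 / (20 * k)).
(* Since c - b = k = m K, the m updates cannot push c - S below b. *)
have pw w : psd (c%:M - S w - b%:M).
  have -> : c%:M - S w - b%:M = \sum_(i < m) (K%:M - (x (w i))^T *m x (w i)).
    rewrite sumrB sumr_const card_ord -raddfMn /= Km -/(S w) addrAC -raddfB /=.
    by congr (_%:M - _); rewrite /c /b; ring.
  by apply: psd_sum => i; apply: psd_sub_outer.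
have J0 := ler0n R #|I|.
(* From Q < 20m the left side is below 20/99. A gain factor of at least 3/4 remains, and 20 (3/4) /
   100 is the 3/20 in [th]. *)
have beta : Q%:R * K / b <= 1 / 4.
  have -> : Q%:R * K / b = Q%:R / m%:R / 99 by rewrite /K /b; field; rewrite !gt_eqF.
  have : Q%:R / m%:R <= 20 :> R by rewrite ler_pdivrMr // -QR ler_nat.
  lra.
have ik : 0 < k^-1 <= 1 by rewrite invr_gt0 k0 invf_le1.
have E20 : 3 / (20 * k) = 3 / 20 * k^-1 by field; rewrite gt_eqF.
have E100 : 3 / (100 * k) = 3 / 100 * k^-1 by field; rewrite gt_eqF.
have step : \sum_w \tr ((c%:M - S w) ^+ Q.+1) <= th ^+ m * \tr ((c%:M : 'M[R]_n) ^+ Q.+1).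
  apply: (sum_trace_iter (b := b) (c := c) xs xK) => //.
  - by apply: divr_ge0 => //; apply: ltW.
  - lra.
  - rewrite QR /th E20.
    have -> : 20 * m%:R * (1 - Q%:R * K / b) * (#|I|%:R / m%:R) / c =
      #|I|%:R * (k^-1 / 5 * (1 - Q%:R * K / b)).
      by rewrite /c; field; rewrite !gt_eqF.
    have h : 3 / 20 * k^-1 <= k^-1 / 5 * (1 - Q%:R * K / b) by nra.
    by have := ler_wpM2l J0 h; lra.
  - by rewrite mulr_ge0 // E20; lra.
  - have -> : c = b + K *+ m by rewrite Km /c /b; ring.
    by rewrite subrr; have := @psd_scalar R n 0 (lexx 0); rewrite raddf0.
  - by rewrite subrr; have := @psd_scalar R n 0 (lexx 0); rewrite raddf0.
have trc : \tr ((c%:M : 'M[R]_n) ^+ Q.+1) = n%:R * c ^+ Q.+1.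
  by rewrite -rmorphXn /= mxtrace_scalar mulr_natl.
pose a := c - 3 / 5; have a0 : 0 < a by rewrite /a /c; lra.
(* The comparison for a single trial: Bernoulli gives (1 - 3/(500k))^20 >= 1 - 3/(25k), and 3/20 =
   3/25 + 3/100 leaves the factor 1 - 3/(100k). *)
have h1 : c ^+ e * th <= #|I|%:R * (1 - 3 / (100 * k)) * a ^+ e.
  have -> : a = c * (1 - 3 / 500 * k^-1) by rewrite /a /c; field; rewrite gt_eqF.
  rewrite [(c * _) ^+ e]exprMn /th E20 E100 mulrCA -[leRHS]mulrA; apply: ler_wpM2l => //.
  rewrite [leRHS]mulrCA; apply: ler_wpM2l; first by rewrite exprn_ge0 // ltW.
  have bern : 1 - e%:R * (3 / 500 * k^-1) <= (1 - 3 / 500 * k^-1) ^+ e.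
    by apply: bernoulli_ineq; lra.
  have h : 0 <= 1 - 3 / 100 * k^-1 by lra.
  by apply: le_trans (ler_wpM2l h bern); rewrite Ee; nra.
have aq0 : 0 < a ^+ Q.+1 by rewrite exprn_gt0.
(* Markov's inequality for the potential: a bad outcome contributes at least a^q, any other a
   nonnegative amount. *)
have : \sum_(w | `[< exists y : 'rV[R]_n, fdot (y *m S w) y < 3 / 5 * fdot y y >]) a ^+ Q.+1
    <= n%:R * c ^+ Q.+1 * th ^+ m.
  rewrite -trc [leRHS]mulrC; apply: le_trans step.
  rewrite big_mkcond /=; apply: ler_sum => w _; case: ifPn => [/asboolP[y Sy]|_].
    have y0 : y != 0.
      by apply: contraTneq Sy => ->; rewrite mul0mx fdot0l mulr0 ltxx.
    apply: exprn_le_trace b0 (pw w) y0 (ltW a0) _.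
    by rewrite mulmxBr mul_mx_scalar fdotBl fdotZl /a; lra.
  by apply: psd_trace_ge0; apply: psdX; apply: psd_sub_ge0 (pw w); apply: ltW.
under eq_bigr do rewrite -[a ^+ _]mulr1.
rewrite -mulr_sumr.
rewrite [leLHS]mulrC -ler_pdivlMr // => /le_trans; apply.
rewrite ler_pdivrMr // -!mulrA ler_wpM2l //.
rewrite -EQ !exprM -!exprMn; apply: lerXn2r h1; rewrite nnegrE.
  by rewrite mulr_ge0 ?exprn_ge0 ?(ltW c0) // /th E20 mulr_ge0 //; lra.
by rewrite !mulr_ge0 ?exprn_ge0 ?(ltW a0) // E100; lra.
Qed.

End Chernoff.

(** * Second moments and sketched least squares *)


Section LeastSquares.
Variable R : realFieldType.

Lemma fdot_sumr p q (I : finType) (A : 'M[R]_(p, q)) (B : I -> 'M[R]_(p, q)) :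
  fdot A (\sum_i B i) = \sum_i fdot A (B i).
Proof. by rewrite /fdot raddf_sum mulmx_sumr raddf_sum. Qed.

(* Both sides carry a factor #|I|, which avoids the exponent m - 1. *)
Lemma sum_ffun_fdot p q (I : finType) (z : I -> 'M[R]_(p, q)) m :
  \sum_a z a = 0 ->
  #|I|%:R * \sum_(w : {ffun 'I_m -> I})
      fdot (\sum_i z (w i)) (\sum_i z (w i)) =
  m%:R * #|I|%:R ^+ m * \sum_a fdot (z a) (z a).
Proof.
move=> z0; elim: m => [|m IH].
  by rewrite big1 ?mulr0 ?mul0r // => w _; rewrite big_ord0 fdot0l.
rewrite sum_ffun_recl.
set S := fun w : {ffun 'I_m -> I} => \sum_i z (w i).
have -> : \sum_a \sum_(w : {ffun 'I_m -> I})
    fdot (\sum_i z (ffun_cons a w i)) (\sum_i z (ffun_cons a w i)) =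
    \sum_a (#|I|%:R ^+ m * fdot (z a) (z a) + 2 * fdot (z a) (\sum_w S w)
            + \sum_w fdot (S w) (S w)).
  apply: eq_bigr => a _.
  transitivity (\sum_w (fdot (z a) (z a) + 2 * fdot (z a) (S w) + fdot (S w) (S w))).
    apply: eq_bigr => w _; rewrite (sum_ffun_cons _ _ z) -/(S w).
    by rewrite !(fdotDl, fdotDr) (fdotC (S w) (z a)); ring.
  rewrite !big_split /= sumr_const card_ffun card_ord -natrX mulr_natl.
  by rewrite -mulr_sumr -fdot_sumr.
rewrite !big_split /= -!mulr_sumr sumr_const -[in X in _ + X]mulr_natl IH.
have -> : \sum_a fdot (z a) (\sum_w S w) = 0.
  under eq_bigr do rewrite fdotC.
  by rewrite -fdot_sumr z0 fdot0r.
by rewrite exprSr mulrSr; ring.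
Qed.

Lemma fdot_subsq p q (A B : 'M[R]_(p, q)) :
  fdot (A - B) (A - B) = fdot A A - 2 * fdot A B + fdot B B.
Proof. by rewrite !(fdotBl, fdotBr) (fdotC B A); ring. Qed.

Lemma fdot_rows p q (A B : 'M[R]_(p, q)) :
  fdot A B = \sum_i fdot (row i A) (row i B).
Proof.
rewrite fdotE; apply: eq_bigr => i _; rewrite fdotE big_ord1.
by apply: eq_bigr => j _; rewrite !mxE.
Qed.

Lemma fdot_tr p q (A B : 'M[R]_(p, q)) : fdot A^T B^T = fdot A B.
Proof. by rewrite fdotC /fdot trmxK mxtrace_mulC. Qed.

Lemma fdot_outer p q (u : 'rV[R]_p) (v : 'rV[R]_q) :
  fdot (u^T *m v) (u^T *m v) = fdot u u * fdot v v.
Proof.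
rewrite fdot_mull -mulmxA [v *m _]mx11_scalar mul_mx_scalar fdotZr fdot_tr.
by rewrite mulrC /fdot !trace_mx11.
Qed.

Lemma trmulmx_rows l p q (A : 'M[R]_(l, p)) (B : 'M[R]_(l, q)) :
  A^T *m B = \sum_i (row i A)^T *m row i B.
Proof.
apply/matrixP => i j; rewrite mxE summxE; apply: eq_bigr => s _.
by rewrite !mxE big_ord1 !mxE.
Qed.

(** * Sketched minimizers in orthonormal coordinates *)

Section Sketch.
Variables (e J p rk m : nat).
Variables (X : 'M[R]_(e, J)) (A : 'M[R]_(J, p)) (U : 'M[R]_(J, rk)).
Hypothesis U_orth : U^T *m U = 1%:M.
Let F := X - X *m U *m U^T.

Lemma residual_orth : F *m U = 0.
Proof. by rewrite mulmxBl -(mulmxA _ U^T) U_orth mulmx1 subrr. Qed.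

Lemma residualE C :
  fdot (X - C *m U^T) (X - C *m U^T) =
  fdot F F + fdot (C - X *m U) (C - X *m U).
Proof.
set D := C - X *m U.
have -> : X - C *m U^T = F - D *m U^T by rewrite mulmxBl opprB addrA subrK.
rewrite fdot_subsq (fdotC F) !(fdot_mull D) trmxK residual_orth fdot0r.
by rewrite -mulmxA U_orth mulmx1 mulr0 subr0.
Qed.

Hypothesis A_sub : forall H : 'M[R]_(e, p), exists C, H *m A^T = C *m U^T.
Hypothesis U_sub : forall C, exists H : 'M[R]_(e, p), H *m A^T = C *m U^T.

(** With D the deviation from the optimum in [U] coordinates, optimality gives |DW|^2 = <F P^T P U,
    D>. The lower bound [alpha] and Cauchy-Schwarz then bound |D|^2, which [residualE] adds to
    |F|^2. *)
Lemma sketched_least_squares (P : 'M[R]_(m, J)) (alpha beta : R) H :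
  0 < alpha ->
  (forall y : 'rV_rk, alpha * fdot y y <= fdot (y *m (P *m U)^T) (y *m (P *m U)^T)) ->
  fdot (F *m P^T *m (P *m U)) (F *m P^T *m (P *m U)) <= beta * fdot F F ->
  (forall H', fdot (X *m P^T - H *m (P *m A)^T) (X *m P^T - H *m (P *m A)^T) <=
              fdot (X *m P^T - H' *m (P *m A)^T) (X *m P^T - H' *m (P *m A)^T)) ->
  fdot (X - H *m A^T) (X - H *m A^T) <= (1 + beta / alpha ^+ 2) * fdot F F.
Proof.
move=> a0 lb hb Hmin; have [C HC] := A_sub H.
rewrite HC residualE; set D := C - X *m U.
set W := (P *m U)^T in lb.
pose r := F *m P^T - D *m W.
have resE C' H' : H' *m A^T = C' *m U^T ->
    X *m P^T - H' *m (P *m A)^T = F *m P^T - (C' - X *m U) *m W.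
  move=> E; rewrite trmx_mul mulmxA E /F /W trmx_mul !mulmxBl !mulmxA.
  by rewrite opprB addrA subrK.
have orth : fdot r (D *m W) = 0.
  (* |r - t DW|^2 - |r|^2 is nonnegative for all t and has constant term 0, so its linear term
     vanishes. *)
  suff : (- fdot r (D *m W)) ^+ 2 <= 0 * fdot (D *m W) (D *m W).
    by rewrite mul0r sqrrN => h; apply/eqP; rewrite -sqrf_eq0 eq_le h sqr_ge0.
  apply: quadratic_discr (fdot_ge0 _) _ => t.
  have [H' HC'] := U_sub (C + t *: D).
  have := Hmin H'; rewrite (resE _ _ HC) (resE _ _ HC') -/D -/r.
  have -> : F *m P^T - (C + t *: D - X *m U) *m W = r - t *: (D *m W).
    by rewrite addrAC -/D (mulmxDl D) -scalemxAl opprD addrA.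
  by rewrite (fdot_subsq r) fdotZr fdotZl fdotZr; lra.
have DW : fdot (D *m W) (D *m W) = fdot (F *m P^T *m (P *m U)) D.
  have : fdot (F *m P^T) (D *m W) = fdot (D *m W) (D *m W).
    by apply/eqP; rewrite -subr_eq0 -fdotBl orth.
  by move=> <-; rewrite (fdot_mull _ (P *m U)).
have aD : alpha * fdot D D <= fdot (D *m W) (D *m W).
  rewrite !fdot_rows mulr_sumr; apply: ler_sum => i _.
  by rewrite row_mul; apply: lb.
have cs := fdot_cauchy (F *m P^T *m (P *m U)) D; rewrite -DW in cs.
have D0 := fdot_ge0 D; have F0 := fdot_ge0 F.
have hD : (alpha * fdot D D) ^+ 2 <= beta * fdot F F * fdot D D.
  apply: le_trans (le_trans cs (ler_wpM2r D0 hb)).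
  by rewrite lerXn2r ?nnegrE ?fdot_ge0 // mulr_ge0 // ltW.
rewrite mulrDl mul1r lerD2l.
have hb0 := le_trans (fdot_ge0 _) hb.
rewrite mulrAC ler_pdivlMr ?exprn_gt0 //.
move: D0; rewrite le_eqVlt => /predU1P[<-|D0]; first by rewrite mul0r.
by rewrite -(ler_pM2r D0); apply: le_trans hD; rewrite exprMn; lra.
Qed.

End Sketch.
End LeastSquares.

(** * Uniform sampling *)


Section Sampling.
Variable R : realType.

Lemma frobE p q (A : 'M[R]_(p, q)) : frob A = Num.sqrt (fdot A A).
Proof. by rewrite fdot_sqE. Qed.

Lemma frob_sq p q (A : 'M[R]_(p, q)) : frob A ^+ 2 = fdot A A.
Proof. by rewrite frobE sqr_sqrtr ?fdot_ge0. Qed.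

Lemma ler_frob p q p' q' (A : 'M[R]_(p, q)) (B : 'M[R]_(p', q')) :
  (frob A <= frob B) = (fdot A A <= fdot B B).
Proof. by rewrite !frobE ler_sqrt ?fdot_ge0. Qed.

Lemma trmulmx_scale p q (c : R) (u : 'rV[R]_p) (v : 'rV[R]_q) :
  (c *: u)^T *m (c *: v) = c ^+ 2 *: (u^T *m v).
Proof. by rewrite [(c *: u)^T]linearZ -scalemxAl -scalemxAr scalerA. Qed.

Lemma row_uniform_sampling m J q (w : trials m J) (B : 'M[R]_(J, q)) i :
  row i (uniform_sampling R w *m B) = Num.sqrt (J%:R / m%:R) *: row (w i) B.
Proof.
rewrite /uniform_sampling -mulmxA mul_diag_mx; apply/rowP => j; rewrite !mxE.
congr (_ * _); rewrite (bigD1 (w i)) //= big1 ?addr0 => [|l lw]; rewrite !mxE.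
  by rewrite eqxx mul1r.
by rewrite eq_sym (negPf lw) mul0r.
Qed.

Lemma trials_probE m J (E : trials m J -> Prop) :
  trials_prob R E = (\sum_(w | `[< E w >]) 1) * J%:R^-1 ^+ m.
Proof.
rewrite /trials_prob mulr_suml; apply: eq_bigr => w _.
by rewrite prodr_const card_ord mul1r.
Qed.

(** The total mass is 1, and pointwise the indicators of [E], [B1], [B2] sum to at least 1. *)
Lemma trials_prob_union m J (B1 B2 E : trials m J -> Prop) p1 p2 :
  (0 < J)%N -> (forall w, ~ B1 w -> ~ B2 w -> E w) ->
  trials_prob R B1 <= p1 -> trials_prob R B2 <= p2 ->
  1 - (p1 + p2) <= trials_prob R E.
Proof.
move=> J0 BE h1 h2; have JR : J%:R != 0 :> R by rewrite pnatr_eq0 -lt0n.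
rewrite lerBlDr; apply: le_trans (lerD (lexx _) (lerD h1 h2)).
rewrite !trials_probE -!mulrDl exprVn ler_pdivlMr ?exprn_gt0 ?ltr0n // mul1r.
have -> : J%:R ^+ m = \sum_(w : trials m J) 1 :> R.
  by rewrite sumr_const card_ffun !card_ord natrX.
rewrite (big_mkcond (fun w => `[< E w >])) (big_mkcond (fun w => `[< B1 w >])).
rewrite (big_mkcond (fun w => `[< B2 w >])) -!big_split /=; apply: ler_sum => w _.
case: asboolP => [_|nE]; first by do 2 case: ifP; lra.
case: asboolP => [_|n1]; first by case: ifP; lra.
case: asboolP => [_|n2]; first by lra.
by have := nE (BE w n1 n2).
Qed.

Lemma sampled_least_squares e J p m (X : 'M[R]_(e, J)) (A : 'M[R]_(J, p))
    (U : 'M[R]_(J, \rank A)) (k eps delta : R) :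
  let loss H := frob (X - H *m A^T) in
  let sketched_loss (w : trials m J) (H : 'M_(e, p)) :=
    let Psi : 'M[R]_(m, J) := uniform_sampling R w in
    frob (X *m Psi^T - H *m (Psi *m A)^T) in
  (0 < J)%N -> 1 <= k -> p%:R <= k ->
  left_singular_vectors A U -> (forall i, frob (row i U) ^+ 2 <= k / J%:R) ->
  0 < eps < 1 -> 0 < delta < 1 ->
  2 * k / eps * Num.max (48 / eps * ln (96 * k / (eps ^+ 2 * Num.sqrt delta)))
                        (1 / delta) <= m%:R ->
  exists Hopt, is_argmin loss Hopt /\
    1 - delta <= trials_prob R (fun w : trials m J =>
      forall H, is_argmin (sketched_loss w) H -> loss H <= (1 + eps) * loss Hopt).
Proof.
move=> loss sketched_loss J0 k1 pk [V [s [UU VV s0 EA]]] Uk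
  /andP[eps0 eps1] /andP[delta0 delta1] mk.
have k0 : 0 < k by apply: lt_le_trans k1.
have JR : 0 < J%:R :> R by rewrite ltr0n.
have EAT : A^T = V *m diag_mx s *m U^T.
  by rewrite (congr1 trmx EA) !trmx_mul trmxK tr_diag_mx mulmxA.
(* The inverse singular values solve H A^T = C U^T for H in [U_sub]. *)
pose si := map_mx (fun z : R => z^-1) s.
have sK : diag_mx si *m diag_mx s = 1%:M.
  rewrite mulmx_diag; apply/matrixP => i j; rewrite !mxE.
  by rewrite mulVf // gt_eqF // s0.
have A_sub (H : 'M[R]_(e, p)) : exists C, H *m A^T = C *m U^T.
  by exists (H *m V *m diag_mx s); rewrite EAT !mulmxA.
have U_sub C : exists H : 'M[R]_(e, p), H *m A^T = C *m U^T.
  exists (C *m diag_mx si *m V^T).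
  by rewrite EAT !mulmxA -(mulmxA _ V^T) VV mulmx1 -(mulmxA C) sK mulmx1.
pose F := X - X *m U *m U^T.
(* X U U^T is the orthogonal projection of the rows of [X] onto the column space of [U], so it gives
   the minimum. *)
have [Hopt EH] := U_sub (X *m U).
have lossopt : loss Hopt = frob F by rewrite /loss EH.
exists Hopt; split=> [H|].
  rewrite lossopt /loss ler_frob; have [C ->] := A_sub H.
  by rewrite (residualE X UU C) lerDl fdot_ge0.
have FU : F *m U = 0 by apply: residual_orth.
have eps_k : 0 < 2 * k / eps by rewrite divr_gt0 // mulr_gt0.
have m_ge : 2 * k / (eps * delta) <= m%:R.
  have -> : 2 * k / (eps * delta) = 2 * k / eps * (1 / delta).
    by field; rewrite !gt_eqF.
  apply: le_trans mk; rewrite ler_wpM2l ?(ltW eps_k) //.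
  by rewrite le_max lexx orbT.
have mR : 0 < m%:R :> R by apply: lt_le_trans m_ge; rewrite divr_gt0 ?mulr_gt0.
have m0 : (0 < m)%N by rewrite -(ltr0n R).
set q := Num.sqrt (J%:R / m%:R : R).
have qq : q ^+ 2 = J%:R / m%:R by rewrite sqr_sqrtr // divr_ge0.
pose x a := q *: row a U.
have xx a : fdot (x a) (x a) <= k / m%:R.
  rewrite fdotZl fdotZr mulrA -expr2 qq -frob_sq.
  apply: le_trans (ler_wpM2l _ (Uk a)) _; first by rewrite divr_ge0.
  by rewrite le_eqVlt; apply/orP; left; apply/eqP; field; rewrite !gt_eqF.
have xsum : \sum_a (x a)^T *m x a = (#|'I_J|%:R / m%:R)%:M.
  rewrite card_ord -qq -scalemx1 -UU trmulmx_rows scaler_sumr.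
  by apply: eq_bigr => a _; rewrite /x trmulmx_scale.
have gram (w : trials m J) : (uniform_sampling R w *m U)^T *m (uniform_sampling R w *m U)
    = \sum_i (x (w i))^T *m x (w i).
  by rewrite trmulmx_rows; apply: eq_bigr => i _; rewrite row_uniform_sampling.
pose z a := (q *: row a F^T)^T *m x a.
have zE (w : trials m J) : F *m (uniform_sampling R w)^T *m (uniform_sampling R w *m U)
    = \sum_i z (w i).
  have -> : F *m (uniform_sampling R w)^T = (uniform_sampling R w *m F^T)^T.
    by rewrite (trmx_mul _ F^T) trmxK.
  rewrite trmulmx_rows.
  by apply: eq_bigr => i _; rewrite !row_uniform_sampling.
have z0 : \sum_a z a = 0.
  transitivity (q ^+ 2 *: (F^T^T *m U)); last by rewrite trmxK FU scaler0.
  rewrite trmulmx_rows scaler_sumr; apply: eq_bigr => a _.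
  by rewrite /z /x trmulmx_scale.
pose B1 (w : trials m J) := exists y : 'rV[R]_(\rank A),
  fdot (y *m \sum_i (x (w i))^T *m x (w i)) y < 3 / 5 * fdot y y.
pose B2 (w : trials m J) :=
  18 / 25 * eps * fdot F F < fdot (\sum_i z (w i)) (\sum_i z (w i)).
(* The mean of |F Psi^T Psi U|^2 is at most (k/m) |F|^2 <= (eps delta / 2) |F|^2; Markov divides by
   (18/25) eps |F|^2. For F = 0 the strict inequality in [B2] fails. *)
have p2 : trials_prob R B2 <= 25 / 36 * delta.
  have [F0|FN0] := eqVneq F 0.
    rewrite trials_probE big1 ?mul0r => [|w /asboolP]; first by lra.
    by rewrite /B2 -zE F0 !mul0mx !fdot0l mulr0 ltxx.
  have Z0 : 0 < fdot F F by rewrite lt_neqAle fdot_ge0 eq_sym fdot_eq0 FN0.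
  have zz : \sum_a fdot (z a) (z a) <= J%:R * k / m%:R ^+ 2 * fdot F F.
    rewrite -(fdot_tr F) fdot_rows mulr_sumr; apply: ler_sum => a _.
    rewrite fdot_outer fdotZl fdotZr mulrA -expr2 qq.
    apply: le_trans (ler_wpM2l _ (xx a)) _.
      by rewrite mulr_ge0 ?fdot_ge0 ?divr_ge0.
    by rewrite le_eqVlt; apply/orP; left; apply/eqP; field; rewrite gt_eqF.
  have := sum_ffun_fdot m z0; rewrite card_ord => sm.
  have mk2 : k / m%:R <= eps * delta / 2.
    move: m_ge; rewrite ler_pdivrMr ?mulr_gt0 // ler_pdivrMr // => h; lra.
  have : (\sum_(w | `[< B2 w >]) 1) * (18 / 25 * eps * fdot F F)
      <= J%:R ^+ m * (k / m%:R) * fdot F F.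
    rewrite -(ler_pM2l JR); apply: le_trans (_ : J%:R * \sum_(w : {ffun 'I_m -> 'I_J})
      fdot (\sum_i z (w i)) (\sum_i z (w i)) <= _).
      rewrite ler_wpM2l // mulr_suml big_mkcond; apply: ler_sum => w _.
      by case: ifPn => [/asboolP/ltW|_]; rewrite ?mul1r ?fdot_ge0.
    rewrite sm; apply: le_trans (ler_wpM2l _ zz) _; first by rewrite mulr_ge0 ?exprn_ge0.
    by rewrite le_eqVlt; apply/orP; left; apply/eqP; field; rewrite gt_eqF.
  rewrite mulrA ler_pM2r // trials_probE exprVn ler_pdivrMr ?exprn_gt0 // => h.
  have Jm : 0 < J%:R ^+ m :> R by rewrite exprn_gt0.
  have := ler_wpM2l (ltW Jm) mk2; rewrite -(ler_pM2r eps0); nra.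
(* The share 11/36 is what Markov left. Chernoff gives at most k / y^2 = eps^4 delta / (9216 k), far
   below it; squaring y turns the square root of delta into delta. *)
have p1 : trials_prob R B1 <= 11 / 36 * delta.
  have := matrix_chernoff m0 k1 xsum xx; rewrite card_ord => ch.
  rewrite trials_probE; apply: le_trans (ler_wpM2r _ ch) _; first by rewrite exprn_ge0 ?invr_ge0.
  rewrite -[leLHS]mulrA -exprMn (mulrC J%:R) mulfK ?gt_eqF //.
  set y := 96 * k / (eps ^+ 2 * Num.sqrt delta) in mk.
  have sd0 : 0 < Num.sqrt delta by rewrite sqrtr_gt0.
  have y0 : 0 < y by rewrite divr_gt0 ?mulr_gt0 ?exprn_gt0.
  have y1 : 1 <= y.
    rewrite ler_pdivlMr ?mulr_gt0 ?exprn_gt0 // mul1r.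
    have : Num.sqrt delta <= 1 by rewrite -[leRHS]sqrtr1 ler_sqrt // ltW.
    have : eps ^+ 2 <= 1 by rewrite expr_le1 ?ltW.
    have : 0 < eps ^+ 2 by rewrite exprn_gt0.
    by nra.
  have mL : 96 * k * ln y <= m%:R.
    apply: le_trans mk; apply: le_trans (_ : 2 * k / eps * (48 / eps * ln y) <= _).
      have -> : 2 * k / eps * (48 / eps * ln y) = 96 * k * ln y * (eps^-1) ^+ 2.
        by field; rewrite gt_eqF.
      rewrite ler_peMr ?mulr_ge0 ?ln_ge0 ?(ltW k0) //.
      by rewrite exprn_ege1 // invf_ge1 // ltW.
    by rewrite ler_wpM2l ?(ltW eps_k) // le_max lexx.
  (* From m >= 96 k ln y the exponent 3m/(100k) is at least 2.88 ln y, and 2 ln y suffices. *)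
  have ex : (1 - 3 / (100 * k)) ^+ m <= (y ^+ 2)^-1.
    apply: le_trans (_ : expR (- (3 / (100 * k))) ^+ m <= _).
      apply: lerXn2r (expR_ge1Dx _); rewrite nnegrE ?expR_ge0 //.
      by rewrite subr_ge0 ler_pdivrMr ?mulr_gt0 //; lra.
    rewrite -expRM_natl -[y in y ^+ 2]lnK ?posrE // -expRM_natl -expRN ler_expR.
    have E100 : m%:R * - (3 / (100 * k)) = - (3 / 100 * (m%:R / k)).
      by field; rewrite gt_eqF.
    have : 96 * ln y <= m%:R / k by rewrite ler_pdivlMr //; lra.
    have := ln_ge0 y1; rewrite E100; lra.
  apply: le_trans (ler_wpM2l (ler0n _ _) ex) _.
  have rk : (\rank A)%:R <= k by apply: le_trans pk; rewrite ler_nat rank_leq_col.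
  apply: le_trans (ler_wpM2r _ rk) _; first by rewrite invr_ge0 exprn_ge0 // ltW.
  have -> : (y ^+ 2)^-1 = eps ^+ 4 * delta / (9216 * k ^+ 2).
    rewrite -[X in _ * X / _](sqr_sqrtr (ltW delta0)) /y; field.
    by rewrite !gt_eqF.
  have -> : k * (eps ^+ 4 * delta / (9216 * k ^+ 2)) = eps ^+ 4 * delta * k^-1 / 9216.
    by field; rewrite gt_eqF.
  have e4 : eps ^+ 4 <= 1 by rewrite expr_le1 ?ltW.
  have e40 : 0 <= eps ^+ 4 by rewrite exprn_ge0 // ltW.
  have ik : k^-1 <= 1 by rewrite invf_le1.
  have ik0 : 0 < k^-1 by rewrite invr_gt0.
  have h1 : eps ^+ 4 * delta <= delta by rewrite ler_piMl // ltW.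
  have h2 : eps ^+ 4 * delta * k^-1 <= eps ^+ 4 * delta.
    by rewrite ler_piMr // mulr_ge0 // ltW.
  lra.
have -> : delta = 11 / 36 * delta + 25 / 36 * delta by lra.
apply: trials_prob_union J0 _ p1 p2 => w n1 n2 H Hmin.
(* Here alpha = 3/5 and beta = (18/25) eps, so beta / alpha^2 = 2 eps, and 1 + 2 eps <= (1 + eps)^2
   gives the claim after square roots. *)
have hl : fdot (X - H *m A^T) (X - H *m A^T) <=
    (1 + 18 / 25 * eps / (3 / 5) ^+ 2) * fdot F F.
  apply: (sketched_least_squares UU A_sub U_sub (P := uniform_sampling R w)).
  - lra.
  - move=> y; rewrite fdot_mull trmxK -mulmxA gram fdotC leNgt.
    by apply/negP => h; apply: n1; exists y.
  - by rewrite zE leNgt; apply/negP.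
  - by move=> H'; rewrite -ler_frob; apply: Hmin.
rewrite lossopt -(ler_pXn2r (n := 2)) ?nnegrE ?mulr_ge0 ?sqrtr_ge0 //; last by lra.
rewrite /loss exprMn !frob_sq; apply: le_trans hl _.
apply: ler_wpM2r; first exact: fdot_ge0.
by have -> : 18 / 25 * eps / (3 / 5) ^+ 2 = 2 * eps :> R; [field|nra].
Qed.

End Sampling.

Theorem theorem3p1 (R : realType) (N : nat) (d r : 'I_N -> nat)
    (d_gt0 : forall k, (0 < d k)%N) (r_gt0 : forall k, (0 < r k)%N)
    (X : multi_index d -> R) (G : tr_cores R d r) (n : 'I_N)
    (U : 'M[R]_(other_size d n, \rank (unfolding2 (subchain G n))))
    (gamma eps delta : R) (m : nat) :
  let J := other_size d n in
  let RR : R := (r n)%:R * (r (ordS n))%:R in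
  let Xn : 'M[R]_(d n, J) := unfolding n X in
  let Gn : 'M[R]_(J, r n * r (ordS n)) := unfolding2 (subchain G n) in
  let loss (H : 'M[R]_(d n, r n * r (ordS n))) := frob (Xn - H *m Gn^T) in
  let sketched_loss (w : trials m J) (H : 'M[R]_(d n, r n * r (ordS n))) :=
    let Psi : 'M[R]_(m, J) := uniform_sampling R w in
    frob (Xn *m Psi^T - H *m (Psi *m Gn)^T) in
  left_singular_vectors Gn U ->
  1 < gamma ->
  (forall i, frob (row i U) ^+ 2 <= gamma * RR / J%:R) ->
  0 < eps < 1 ->
  0 < delta < 1 ->
  m%:R >= (2 * gamma * RR / eps) *
    Num.max (48 / eps * ln (96 * gamma * RR / (eps ^+ 2 * Num.sqrt delta)))
            (1 / delta) ->
  exists Hopt, is_argmin loss Hopt /\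
    1 - delta <= trials_prob R (fun w : trials m J =>
      forall H, is_argmin (sketched_loss w) H -> loss H <= (1 + eps) * loss Hopt).
Proof.
move=> J RR Xn Gn loss sketched_loss hU g1 Uk heps hdelta hm.
have RR1 : 1 <= RR by rewrite /RR -natrM ler1n muln_gt0 !r_gt0.
have pk : RR <= gamma * RR by rewrite ler_peMl ?(ltW g1) // (le_trans ler01).
(* The parameter k is gamma R_n R_(n+1); positive ranks and gamma > 1 make it at least 1 and at
   least the number of columns of [Gn]. *)
apply: (@sampled_least_squares R _ _ _ m Xn Gn U (gamma * RR)) => //.
- by rewrite /J /other_size prodn_gt0.
- exact: le_trans pk.
- by rewrite natrM.
- by rewrite !mulrA in hm *.
Qed.
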